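(* Let $\mathcal L$ be the Heisenberg–Virasoro algebra with basis $\{L_n,I_n,z_1,z_2,z_3: n\in\mathbb Z\}$ and brackets $[L_m,L_n]=(n-m)L_{m+n}+\frac{m^3-m}{12}\delta_{m+n,0}z_1$, $[I_m,I_n]=m\delta_{m+n,0}z_3$, $[L_m,I_n]=nI_{m+n}+\delta_{m+n,0}(m^2+m)z_2$, $[I_0,\mathcal L]=[z_1,\mathcal L]=[z_2,\mathcal L]=[z_3,\mathcal L]=0$. Let $\mathcal H=\mathrm{Span}\{I_r,z_3: r\in\mathbb Z\}$ and $\mathfrak p=\mathrm{Span}\{I_n,z_1,z_2,z_3: n\in\mathbb Z\}$. Let $\phi:\mathfrak p\to\mathbb C$ be a finite Lie algebra homomorphism with $\phi(\mathcal H)\neq 0$, and $S^\phi=\{n\in\mathbb Z:\phi(I_n)\neq 0\}$. Then $W(\phi)$ is irreducible if and only if $|S^\phi|\ge 2$.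
   Context: A Lie algebra homomorphism $\phi:\mathfrak p\to\mathbb C$ is a linear map vanishing on $[\mathfrak p,\mathfrak p]=\mathbb C z_3$. $\phi$ is called finite if $S^\phi$ is finite and $\phi(z_2)=0$. $W(\phi)=\mathcal U(\mathcal L)\otimes_{\mathcal U(\mathfrak p)}\mathbb C w_\phi$, where $\mathbb C w_\phi$ is the one-dimensional $\mathfrak p$-module with $pw_\phi=\phi(p)w_\phi$. *)

(* Defs.v *)
(* Heisenberg--Virasoro algebra, its tensor algebra
   (free associative algebra on the basis of L), and the induced module
   W(phi) = U(L) (x)_{U(p)} C w_phi, presented as the quotient of the
   tensor algebra T(L) by the left ideal K_phi. *)
From HB Require Import structures.
From mathcomp Require Import all_boot all_order all_algebra.
From mathcomp Require Import finmap.
From mathcomp.multinomials Require Import monalg.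
From mathcomp Require Import reals.
From mathcomp.real_closed Require Import complex.

Set Implicit Arguments.
Unset Strict Implicit.
Unset Printing Implicit Defensive.

Import Order.TTheory GRing.Theory Num.Theory.
Local Open Scope ring_scope.

Inductive HVbasis : Type :=
| Lb of int
| Ib of int
| z1b | z2b | z3b.

Definition HVenc (x : HVbasis) : int * nat :=
  match x with
  | Lb n => (n, 0%N) | Ib n => (n, 1%N)
  | z1b => (0, 2%N) | z2b => (0, 3%N) | z3b => (0, 4%N)
  end.
Definition HVdec (p : int * nat) : HVbasis :=
  match p with
  | (n, 0%N) => Lb n | (n, 1%N) => Ib n
  | (_, 2%N) => z1b | (_, 3%N) => z2b | (_, _) => z3b
  end.
Lemma HVencK : cancel HVenc HVdec. Proof. by case. Qed.
HB.instance Definition _ := Equality.copy HVbasis (can_type HVencK).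
HB.instance Definition _ := Choice.copy HVbasis (can_type HVencK).
HB.instance Definition _ := Countable.copy HVbasis (can_type HVencK).

Inductive pbasis : Type :=
| pI of int | pz1 | pz2 | pz3.
Definition p_to_HV (g : pbasis) : HVbasis :=
  match g with pI n => Ib n | pz1 => z1b | pz2 => z2b | pz3 => z3b end.

Section HV.
Variable C : fieldType.

Definition TL := {malg C[{fmonom HVbasis}]}.

Definition gen (x : HVbasis) : TL := << fmu x >>.

Definition delta0 (k : int) : C := if k == 0 then 1 else 0.

Definition HVbracket (x y : HVbasis) : TL :=
  match x, y with
  | Lb m, Lb n => (n - m)%:~R *: gen (Lb (m + n))
                  + (delta0 (m + n) * ((m ^+ 3 - m)%:~R / 12%:R)) *: gen z1b
  | Ib m, Ib n => (delta0 (m + n) * m%:~R) *: gen z3b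
  | Lb m, Ib n => n%:~R *: gen (Ib (m + n))
                  + (delta0 (m + n) * (m ^+ 2 + m)%:~R) *: gen z2b
  | Ib n, Lb m => - (n%:~R *: gen (Ib (m + n))
                  + (delta0 (m + n) * (m ^+ 2 + m)%:~R) *: gen z2b)
  | _, _ => 0
  end.

Variable phi : pbasis -> C.

(* K_phi: the C-span of u (x y - y x - [x,y]) v  (two-sided ideal defining
   U(L)) and of u (g - phi g) for g in p (left ideal U(L)(p - phi(p))). *)
Inductive inK : TL -> Prop :=
| K_rel (u v : TL) (x y : HVbasis) :
    inK (u * (gen x * gen y - gen y * gen x - HVbracket x y) * v)
| K_ind (u : TL) (g : pbasis) : inK (u * (gen (p_to_HV g) - (phi g)%:A))
| K_zero : inK 0
| K_add (a b : TL) : inK a -> inK b -> inK (a + b)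
| K_scale (c : C) (a : TL) : inK a -> inK (c *: a).

(* W(phi) = TL / K_phi.  An L-submodule of W(phi) is described by its
   preimage S in TL: a subspace containing K_phi, stable under the action
   of L (left multiplication by the basis elements of L). *)
Definition W_submodule (S : TL -> Prop) : Prop :=
  [/\ forall t, inK t -> S t,
      S 0,
      (forall a b, S a -> S b -> S (a + b)),
      (forall (c : C) a, S a -> S (c *: a))
    & forall (x : HVbasis) a, S a -> S (gen x * a)].

(* W(phi) is irreducible: W(phi) <> 0 (i.e. the class of 1 is nonzero) and
   every submodule is 0 (preimage K_phi) or W(phi) (preimage TL). *)
Definition W_irreducible : Prop :=
  ~ inK 1 /\
  forall S, W_submodule S ->
    (forall t, S t -> inK t) \/ (forall t, S t).

End HV.

(* Main.v *)
Require Import Defs.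
From HB Require Import structures.
From mathcomp Require Import ssrAC all_boot all_order all_algebra finmap.
From mathcomp.multinomials Require Import monalg.
From mathcomp Require Import boolp reals.
From mathcomp.real_closed Require Import complex.
From mathcomp Require Import ring zify.

(* Filter W(phi) by the number of factors L_m. On leading terms, viewed as
   polynomials in variables x_m, the operator I_n - phi(I_n) acts as
   -n sum_m phi(I_(m+n)) d/dx_m. Let N and M be the least and the greatest element
   of S^phi. If N < M then, on polynomials in finitely many variables, a triangular
   elimination with n = M - m (for m < M) and n = N - m (for m > N) expresses each
   d/dx_m through these operators, so Euler's identity sum_m x_m d/dx_m = degree
   shows that a vector killed by all I_n - phi(I_n) has degree 0. Every nonzero
   submodule contains such a vector, hence w_phi. No linear independence of the
   PBW monomials is needed.

   That classes in W(phi) are nonzero is shown by functionals: W(phi) maps to the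
   dual of a polynomial algebra on which the Lie algebra acts by differential
   operators, with w_phi sent to an evaluation. If S^phi = {r}, suitable
   evaluations show that L_r w_phi is nonzero and generates a submodule not
   containing w_phi. *)

Set Implicit Arguments.
Unset Strict Implicit.
Unset Printing Implicit Defensive.

Import Order.TTheory GRing.Theory Num.Theory.
Local Open Scope ring_scope.

(** * Whittaker vectors have degree zero *)

(* [T] and [K] stand for the tensor algebra and the left ideal of the induced
   module: over an abstract algebra unification does not unfold the monoid
   algebra. *)
Section Filtration.
Variables (C : numFieldType) (T : algType C) (gen : HVbasis -> T).
Variables (phi : pbasis -> C) (K : T -> Prop).
Local Notation L m := (gen (Lb m)).
Local Notation I n := (gen (Ib n)).

Hypothesis T_ind : forall Q : T -> Prop,
  (forall a b, Q a -> Q b -> Q (a + b)) -> (forall c a, Q a -> Q (c *: a)) ->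
  Q 1 -> (forall x a, Q a -> Q (gen x * a)) -> forall t, Q t.
Hypotheses (K0 : K 0) (KD : forall a b, K a -> K b -> K (a + b))
  (KZ : forall c a, K a -> K (c *: a)) (KM : forall u a, K a -> K (u * a)).
Hypothesis K_ind : forall g, K (gen (p_to_HV g) - (phi g)%:A).
Hypothesis K_LL : forall m n v, exists c,
  K (L m * (L n * v) -
     (L n * (L m * v) + ((n - m)%:~R *: (L (m + n) * v) + c *: (gen z1b * v)))).
Hypothesis K_IL : forall n m v, exists c,
  K (I n * (L m * v) -
     (L m * (I n * v) - (n%:~R *: (I (m + n) * v) + c *: (gen z2b * v)))).
Hypothesis K_zL : forall z m v, z \in [:: z1b; z2b; z3b] ->
  K (gen z * (L m * v) - L m * (gen z * v)).
Hypothesis phi_z2 : phi pz2 = 0.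

Implicit Types (A : pred int) (t a b : T) (s : seq int).

Definition word s : T := foldr (fun m t => L m * t) 1 s.

(** The letters of a word come in no prescribed order. The bound on the length is strict, so that
    [Fil A 0] is [K] and [Fil A 1] is [K] plus the scalars. *)
Inductive Fil A (r : nat) : T -> Prop :=
| FilK t : K t -> Fil A r t
| FilW s : all A s -> (size s < r)%N -> Fil A r (word s)
| FilD a b : Fil A r a -> Fil A r b -> Fil A r (a + b)
| FilZ c a : Fil A r a -> Fil A r (c *: a).

Lemma Fil_mono A A' r r' t :
  subpred A A' -> (r <= r')%N -> Fil A r t -> Fil A' r' t.
Proof.
move=> sAA' le_rr'; elim=> [a Ka|s As ltsr|a b _ Fa _ Fb|c a _ Fa].
- exact: FilK.
- by apply: FilW; [exact: sub_all As|exact: leq_trans le_rr'].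
- exact: FilD.
- exact: FilZ.
Qed.

Lemma Fil_leq A r r' t : (r <= r')%N -> Fil A r t -> Fil A r' t.
Proof. exact: Fil_mono. Qed.

Lemma FilN A r a : Fil A r a -> Fil A r (- a).
Proof. by rewrite -scaleN1r; apply: FilZ. Qed.

Lemma FilB A r a b : Fil A r a -> Fil A r b -> Fil A r (a - b).
Proof. by move=> Fa Fb; apply: FilD => //; apply: FilN. Qed.

Lemma Fil_sum A r (D : eqType) (l : seq D) (F : D -> T) :
  {in l, forall i, Fil A r (F i)} -> Fil A r (\sum_(i <- l) F i).
Proof.
move=> FF; rewrite big_seq.
by elim/big_ind: _ => // [|a b]; [exact: FilK|exact: FilD].
Qed.

Lemma Fil_cong A r a b : Fil A r (a - b) -> Fil A r b -> Fil A r a.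
Proof. by move=> Fab Fb; rewrite -(subrK b a); apply: FilD. Qed.

Lemma Fil_Kcong A r a b : K (a - b) -> Fil A r b -> Fil A r a.
Proof. by move=> Kab; apply: Fil_cong; apply: FilK. Qed.

Lemma Fil0_K A t : Fil A 0 t -> K t.
Proof. by elim=> // *; [apply: KD|apply: KZ]. Qed.

Lemma Fil_lmulL A r m t : A m -> Fil A r t -> Fil A r.+1 (L m * t).
Proof.
move=> Am; elim=> [a Ka|s As ltsr|a b _ Fa _ Fb|c a _ Fa].
- by apply/FilK/KM.
- by apply: (FilW (s := m :: s)); rewrite //= Am.
- by rewrite mulrDr; apply: FilD.
- by rewrite -scalerAr; apply: FilZ.
Qed.

Lemma Fil_lmulL_pred A r m t : A m -> Fil A r.-1 t -> Fil A r (L m * t).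
Proof.
by case: r => [|r] Am; [move/Fil0_K=> Kt; apply/FilK/KM|exact: Fil_lmulL].
Qed.

(** Commuting an element of p past some [L m] leaves elements of p, so no new letter arises and the
    length does not grow; at the end of the word the scalar [phi g] comes out. *)
Lemma Fil_word_lmulp A g s :
  all A s -> Fil A (size s).+1 (gen (p_to_HV g) * word s).
Proof.
elim: s g => [|m s IH] g /=.
  move=> _; rewrite mulr1; apply: Fil_Kcong (K_ind g) _.
  by apply/FilZ/(FilW (s := [::])).
case/andP=> Am As.
have FLg g' : Fil A (size s).+2 (L m * (gen (p_to_HV g') * word s)).
  by apply: Fil_lmulL => //; apply: IH.
have IHw g' c : Fil A (size s).+2 (c *: (gen (p_to_HV g') * word s)).
  by apply: FilZ; apply: Fil_leq (IH g' As).
case: g => [n|||] /=.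
- have [c Kc] := K_IL n m (word s).
  apply: Fil_Kcong Kc _; apply: FilB; first exact: (FLg (pI n)).
  by apply: FilD; [exact: (IHw (pI _))|exact: (IHw pz2)].
- by apply: Fil_Kcong (K_zL _ _ _) (FLg pz1).
- by apply: Fil_Kcong (K_zL _ _ _) (FLg pz2).
- by apply: Fil_Kcong (K_zL _ _ _) (FLg pz3).
Qed.

Lemma Fil_lmulp A r g t : Fil A r t -> Fil A r (gen (p_to_HV g) * t).
Proof.
elim=> [a Ka|s As ltsr|a b _ Fa _ Fb|c a _ Fa].
- by apply/FilK/KM.
- by apply: Fil_leq (Fil_word_lmulp g As).
- by rewrite mulrDr; apply: FilD.
- by rewrite -scalerAr; apply: FilZ.
Qed.

Lemma Fil_exhaustive t : exists r, Fil predT r t.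
Proof.
elim/T_ind: t => [a b [r Fa] [r' Fb]|c a [r Fa]||x a [r Fa]].
- exists (maxn r r'); apply: FilD.
    by apply: Fil_leq Fa; rewrite leq_maxl.
  by apply: Fil_leq Fb; rewrite leq_maxr.
- by exists r; apply: FilZ.
- by exists 1%N; apply: (FilW (s := [::])).
- exists r.+1; case: x => [m|n|||]; first exact: Fil_lmulL.
  + by apply: Fil_leq (Fil_lmulp (pI n) Fa).
  + by apply: Fil_leq (Fil_lmulp pz1 Fa).
  + by apply: Fil_leq (Fil_lmulp pz2 Fa).
  + by apply: Fil_leq (Fil_lmulp pz3 Fa).
Qed.

(** * Leading symbols of the operators [J n] *)

Definition J (n : int) : T := I n - (phi (pI n))%:A.

(* The derivation sending [L m] to the scalar [g m], applied to [word s]. *)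
Fixpoint contract (g : int -> C) s : T :=
  if s is m :: s' then g m *: word s' + L m * contract g s' else 0.

Lemma Fil_contract A g s : all A s -> Fil A (size s) (contract g s).
Proof.
elim: s => [|m s IH] /=; first by move=> _; apply/FilK/K0.
case/andP=> Am As; apply: FilD; last by apply: Fil_lmulL => //; apply: IH.
by apply: FilZ; apply: FilW.
Qed.

Lemma contractD g h s :
  contract (fun m => g m + h m) s = contract g s + contract h s.
Proof.
by elim: s => [|m s /= ->]; rewrite ?addr0 //= mulrDr scalerDl addrACA.
Qed.

Lemma contractZ c g s : contract (fun m => c * g m) s = c *: contract g s.
Proof.
by elim: s => [|m s /= ->]; rewrite ?scaler0 //= -scalerAr scalerDr scalerA.
Qed.

Lemma eq_in_contract A g h s :
  {in A, g =1 h} -> all A s -> contract g s = contract h s.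
Proof.
by move=> gh; elim: s => //= m s IH /andP[Am As]; rewrite gh // IH.
Qed.

(** The bracket of [I n] and [L m] to leading order: [I (m + n)] is replaced by its value under
    [phi], and the [z2] term vanishes. *)
Definition jsymbol n (m : int) : C := - (n%:~R * phi (pI (m + n))).

Lemma K_z2_word s : K (gen z2b * word s).
Proof.
elim: s => [|m s IH] /=.
  by rewrite mulr1; have := K_ind pz2; rewrite phi_z2 scale0r subr0.
rewrite -[X in K X](subrK (L m * (gen z2b * word s))).
by apply: KD; [apply: K_zL|apply: KM].
Qed.

(** Leibniz rule: moving [J n] through the word gives one commutator per letter, and replacing
    [I (m + n)] by its scalar leaves [J (m + n)], which lowers the length once more. *)
Lemma J_word A n s :
  all A s -> Fil A (size s).-1 (J n * word s - contract (jsymbol n) s).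
Proof.
elim: s n => [|m s IH] n /=.
  by move=> _; rewrite subr0 mulr1; apply: FilK; apply: (K_ind (pI n)).
case/andP=> Am As; have [c Kc] := K_IL n m (word s).
set W := word s in Kc *; set D := contract (jsymbol n) s.
have -> : J n * (L m * W) - (jsymbol n m *: W + L m * D)
  = (I n * (L m * W) -
      (L m * (I n * W) - (n%:~R *: (I (m + n) * W) + c *: (gen z2b * W))))
    + L m * (J n * W - D) - n%:~R *: (J (m + n) * W) - c *: (gen z2b * W).
  rewrite /J !mulrBl mulrBr mulrBr -!scalerAl !mul1r -scalerAr scalerBr scalerA.
  rewrite /jsymbol scaleNr !opprD !opprK.
  by rewrite !addrA [RHS](ACl (1*6*9*7*4*10*3*8*5*2))%AC /= !addrK.
apply: FilB; last by apply: FilZ; apply: FilK; apply: K_z2_word.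
apply: FilB; last first.
  apply: FilZ; apply: Fil_cong (Fil_contract (jsymbol (m + n)) As).
  by apply: Fil_leq (IH _ As); rewrite leq_pred.
apply: FilD; first exact: FilK.
by apply: Fil_lmulL_pred => //; apply: IH.
Qed.

Lemma J_lower A n r t : Fil A r.+1 t -> Fil A r (J n * t).
Proof.
elim=> [a Ka|s As ltsr|a b _ Fa _ Fb|c a _ Fa].
- by apply/FilK/KM.
- apply: (@Fil_leq _ (size s)) => //.
  apply: Fil_cong (Fil_contract (jsymbol n) As).
  by apply: Fil_leq (J_word n As); rewrite leq_pred.
- by rewrite mulrDr; apply: FilD.
- by rewrite -scalerAr; apply: FilZ.
Qed.

Definition whittaker t := forall n, K (J n * t).

(** Such an [e] acts as the derivation [g] up to lower terms and kills Whittaker vectors. The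
    realizable [g] are closed under linear combinations, which permits Gaussian elimination on
    symbols. *)
Definition realizable A (g : int -> C) := exists e : T,
  (forall t, whittaker t -> K (e * t)) /\
  (forall s, all A s -> Fil A (size s).-1 (e * word s - contract g s)).

Lemma realizable_J A n : realizable A (jsymbol n).
Proof. by exists (J n); split=> [t /(_ n)|s /J_word]. Qed.

Lemma realizable_eq A g h :
  {in A, g =1 h} -> realizable A g -> realizable A h.
Proof.
move=> gh [e [eK eF]]; exists e; split=> // s As.
by rewrite -(eq_in_contract gh As); apply: eF.
Qed.

Lemma realizableZ A c g : realizable A g -> realizable A (fun m => c * g m).
Proof.
case=> e [eK eF]; exists (c *: e); split=> [t wt|s As].
  by rewrite -scalerAl; apply/KZ/eK.
by rewrite contractZ -scalerAl -scalerBr; apply/FilZ/eF.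
Qed.

Lemma realizableD A g h :
  realizable A g -> realizable A h -> realizable A (fun m => g m + h m).
Proof.
case=> [e [eK eF]] [f [fK fF]]; exists (e + f); split=> [t wt|s As].
  by rewrite mulrDl; apply: KD; [apply: eK|apply: fK].
by rewrite contractD mulrDl opprD addrACA; apply: FilD; [apply: eF|apply: fF].
Qed.

Lemma realizable0 A g : {in A, forall m, g m = 0} -> realizable A g.
Proof.
move=> g0; apply: (realizable_eq _ (realizableZ 0 (realizable_J A 0))).
by move=> m Am; rewrite mul0r g0.
Qed.

(* Clearing the value at [m] with a multiple of the symbol of [J n]. *)
Lemma realizable_pivot A n m g : jsymbol n m != 0 ->
  realizable A (fun j => g j - g m / jsymbol n m * jsymbol n j) ->
  realizable A g.
Proof.
move=> nz /realizableD/(_ (realizableZ (g m / jsymbol n m) (realizable_J A n))).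
by apply: realizable_eq => j _; rewrite subrK.
Qed.

(** * Triangular elimination on a bounded range of letters *)

Section Range.
Variables (N M : int) (B : nat).
Hypotheses (ltNM : N < M) (phiN : phi (pI N) != 0) (phiM : phi (pI M) != 0).
Hypothesis phi_supp : forall n, phi (pI n) != 0 -> N <= n <= M.

Let range : pred int := fun m => - B%:Z <= m <= B%:Z.

Lemma phi_out n : ~~ (N <= n <= M) -> phi (pI n) = 0.
Proof. by move=> out; apply/eqP; apply: contraNT out => /phi_supp. Qed.

(** The pivot at [m < M] is [- (M - m) * phi (pI M)]. The same symbol vanishes at every [j > m],
    since [j + M - m] exceeds [M], so clearing from the top down keeps the zeros already made. *)
Lemma realizable_below (k : nat) g : - B%:Z + k%:Z <= M ->
  {in range, forall m, - B%:Z + k%:Z <= m -> g m = 0} -> realizable range g.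
Proof.
elim: k g => [|k IH] g le_kM gz.
  by apply: realizable0 => m /[dup] /andP[? _] mR; apply: gz; rewrite // addr0.
set m := - B%:Z + k%:Z; have nz : jsymbol (M - m) m != 0.
  rewrite /jsymbol oppr_eq0; apply: mulf_neq0; first by rewrite intr_eq0; lia.
  by rewrite addrC subrK.
apply: (realizable_pivot (n := M - m) nz); apply: IH => [|j jR le_mj]; first lia.
have [->|neq_jm] := eqVneq j m; first by rewrite divfK ?subrr.
rewrite gz //; last lia.
have -> : jsymbol (M - m) j = 0.
  by rewrite /jsymbol phi_out ?mulr0 ?oppr0 //; lia.
by rewrite mulr0 subr0.
Qed.

(** Mirror elimination: the pivots come from the least index [N], and the letters [m > N] are
    cleared from the bottom up. *)
Lemma realizable_above (k : nat) g : N <= B%:Z - k%:Z ->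
  {in range, forall m, m <= B%:Z - k%:Z -> g m = 0} -> realizable range g.
Proof.
elim: k g => [|k IH] g le_Nk gz.
  by apply: realizable0 => m /[dup] /andP[_ ?] mR; apply: gz; rewrite // subr0.
set m := B%:Z - k%:Z; have nz : jsymbol (N - m) m != 0.
  rewrite /jsymbol oppr_eq0; apply: mulf_neq0; first by rewrite intr_eq0; lia.
  by rewrite addrC subrK.
apply: (realizable_pivot (n := N - m) nz); apply: IH => [|j jR le_jm]; first lia.
have [->|neq_jm] := eqVneq j m; first by rewrite divfK ?subrr.
rewrite gz //; last lia.
have -> : jsymbol (N - m) j = 0.
  by rewrite /jsymbol phi_out ?mulr0 ?oppr0 //; lia.
by rewrite mulr0 subr0.
Qed.

Lemma realizable_all g : realizable range g.
Proof.
(* Letters below [M] are cleared with [M]; the others satisfy [j >= M > N] and are cleared with [N].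
   The factor [M - m] of the first kind of pivot would vanish at [m = M]. *)
pose lo j := if j < M then g j else 0; pose hi j := if j < M then 0 else g j.
apply: (@realizable_eq _ (fun j => lo j + hi j)) => [j _|].
  by rewrite /lo /hi; case: ifP; rewrite ?addr0 ?add0r.
apply: realizableD.
  have [ltMB|leBM] := ltP M (- B%:Z).
    apply: realizable0 => m /andP[? _]; rewrite /lo ifF //; lia.
  apply: (@realizable_below (absz (M + B%:Z))) => [|m _ ?]; first lia.
  rewrite /lo ifF //; lia.
have [ltBN|leNB] := ltP B%:Z N.
  apply: realizable0 => m /andP[_ ?]; rewrite /hi ifT //; lia.
apply: (@realizable_above (absz (B%:Z - N))) => [|m _ ?]; first lia.
rewrite /hi ifT //; lia.
Qed.

(** * Euler's operator and the lowering of the degree *)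

Definition letters : seq int := [seq i%:Z - B%:Z | i <- iota 0 (B + B).+1].

Lemma letters_uniq : uniq letters.
Proof. by rewrite map_inj_uniq ?iota_uniq // => i j; lia. Qed.

Lemma mem_letters m : (m \in letters) = range m.
Proof.
apply/mapP/idP => [[i iI ->]|/andP[lem mle]].
  by move: iI; rewrite mem_iota /range; lia.
by exists (absz (m + B%:Z)); [rewrite mem_iota|]; lia.
Qed.

Let dirac (m j : int) : C := (j == m)%:R.

(* Euler's identity [sum_m x_m d/dx_m = degree], up to lower order terms. *)
Lemma euler_word s : all range s ->
  Fil predT (size s)
    (\sum_(m <- letters) L m * contract (dirac m) s - (size s)%:R *: word s).
Proof.
elim: s => [|x s IH] /=.
  move=> _; rewrite scale0r subr0 big1 => [|m _]; last exact: mulr0.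
  exact: FilK.
case/andP=> xR sR.
pose D m := contract (dirac m) s; set W := word s.
have -> : \sum_(m <- letters) L m * (dirac m x *: W + L x * D m)
    = L x * W + \sum_(m <- letters) L m * (L x * D m).
  under eq_bigr => m _ do rewrite mulrDr -scalerAr.
  rewrite big_split /= (bigD1_seq x) ?mem_letters ?letters_uniq //=.
  rewrite /dirac eqxx scale1r big1 ?addr0 // => m; rewrite eq_sym => /negPf->.
  by rewrite scale0r.
(* Swapping [L m] and [L x] isolates the induction hypothesis; the remaining commutators have fewer
   letters. *)
have -> : L x * W + \sum_(m <- letters) L m * (L x * D m)
      - (size s).+1%:R *: (L x * W)
    = L x * (\sum_(m <- letters) L m * D m - (size s)%:R *: W)
      + \sum_(m <- letters) (L m * (L x * D m) - L x * (L m * D m)).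
  rewrite -natr1 scalerDl scale1r mulrBr mulr_sumr sumrB -scalerAr opprD !addrA.
  by rewrite [LHS](ACl (2*3*1*4))%AC [RHS](ACl (3*2*1*4))%AC /= !addrK.
apply: FilD; first by apply: Fil_lmulL => //; apply: IH.
apply: Fil_sum => m _.
have Ds : Fil predT (size s) (D m) by apply/Fil_contract/all_predT.
have [c Kc] := K_LL m x (D m).
apply: (@Fil_cong _ _ _ ((x - m)%:~R *: (L (m + x) * D m) + c *: (gen z1b * D m))).
  by rewrite -addrA -opprD; apply: FilK.
apply: FilD; apply: FilZ; first exact: Fil_lmulL.
by apply: Fil_leq (Fil_lmulp pz1 Ds).
Qed.

(** [o] is the sum of the [L m * e m] with [e m] realizing d/dx_m. The conclusion is over [predT]
    because the bracket of two letters may leave the range. *)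
Lemma euler : exists o : T, (forall t, whittaker t -> K (o * t)) /\
  (forall r t, Fil range r.+1 t -> Fil predT r (o * t - r%:R *: t)).
Proof.
have [e eP] := choice (fun m => realizable_all (dirac m)).
pose o := \sum_(m <- letters) L m * e m.
have oW s : all range s -> Fil predT (size s) (o * word s - (size s)%:R *: word s).
  move=> sR; apply: Fil_cong; last exact: euler_word sR.
  rewrite opprB addrA subrK mulr_suml -sumrB; apply: Fil_sum => m _.
  rewrite -mulrA -mulrBr; apply: Fil_lmulL_pred => //.
  by have [_ /(_ s sR)] := eP m; apply: Fil_mono.
exists o; split=> [t wt|r t].
  rewrite mulr_suml; elim/big_ind: _ => // m _.
  by rewrite -mulrA; apply: KM; apply: (eP m).1.
elim=> [a Ka|s sR ltsr|a b _ Fa _ Fb|c a _ Fa].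
- by apply/FilB; [apply/FilK/KM|apply/FilZ/FilK].
- move: ltsr; rewrite ltnS leq_eqVlt => /predU1P[<-|ltsr]; first exact: oW.
  have Fs : Fil predT r (word s) by apply: FilW; rewrite ?all_predT.
  apply: FilB; last exact: FilZ.
  apply: (@Fil_cong _ _ _ ((size s)%:R *: word s)); last exact: FilZ.
  exact: Fil_leq (ltnW ltsr) (oW s sR).
- by rewrite mulrDr scalerDr opprD addrACA; apply: FilD.
- by rewrite -scalerAr scalerA mulrC -scalerA -scalerBr; apply: FilZ.
Qed.

(** Modulo lower terms [r%:R *: t] equals [o * t], which lies in [K]; dividing by [r] uses
    characteristic zero. *)
Lemma whittaker_lower r t :
  (0 < r)%N -> Fil range r.+1 t -> whittaker t -> Fil predT r t.
Proof.
move=> r_gt0 Ft wt; have [o [oK oF]] := euler.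
have r_neq0 : r%:R != 0 :> C by rewrite pnatr_eq0 -lt0n.
have : Fil predT r (r%:R *: t).
  rewrite -[_ *: t](subKr (o * t)); apply: FilB; first exact/FilK/oK.
  exact: oF.
by move/(FilZ r%:R^-1); rewrite scalerA mulVf // scale1r.
Qed.

End Range.

(** Only finitely many letters occur in one element, so elimination over a bounded range applies to
    it. *)
Lemma Fil_bounded r t : Fil predT r t ->
  exists B : nat, Fil (fun m => - B%:Z <= m <= B%:Z) r t.
Proof.
elim=> [a Ka|s _ ltsr|a b _ [B FB] _ [B' FB']|c a _ [B FB]].
- by exists 0%N; apply: FilK.
- exists (foldr (fun m => maxn `|m|) 0 s); apply: FilW => //.
  elim: s {ltsr} => //= m s IH; apply/andP; split; first lia.
  by apply: sub_all IH => j; lia.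
- exists (maxn B B'); apply: FilD.
    by apply: Fil_mono FB => // m; lia.
  by apply: Fil_mono FB' => // m; lia.
- by exists B; apply: FilZ.
Qed.

(* A vector of [S] outside [K] of least degree is a Whittaker vector, hence
   of degree 0. *)
Lemma submodule_contains1 (N M : int) (S : T -> Prop) t :
  N < M -> phi (pI N) != 0 -> phi (pI M) != 0 ->
  (forall n, phi (pI n) != 0 -> N <= n <= M) ->
  (forall a, K a -> S a) -> (forall a b, S a -> S b -> S (a + b)) ->
  (forall c a, S a -> S (c *: a)) -> (forall x a, S a -> S (gen x * a)) ->
  S t -> ~ K t -> S 1.
Proof.
move=> ltNM phiN phiM phi_supp SK SD SZ SM.
have SN a : S a -> S (- a) by rewrite -scaleN1r; apply: SZ.
have [r] := Fil_exhaustive t; elim: r t => [|r IH] t Ft St nKt.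
  by case: nKt; apply: Fil0_K Ft.
have [wt|/existsNP[n nKn]] := pselect (whittaker t); last first.
  (* [J n * t] stays in the submodule and has smaller degree. *)
  apply: (IH (J n * t)) => //; first exact: J_lower.
  by rewrite mulrBl -scalerAl mul1r; apply: SD; [apply: SM|apply/SN/SZ].
have [r0|r_gt0] := posnP r; last first.
  have [B FB] := Fil_bounded Ft.
  exact: (IH t) (whittaker_lower ltNM phiN phiM phi_supp _ FB wt) _ _.
(* Only the empty word has length less than 1, so [t] is a scalar modulo [K]. *)
have [c Kc] : exists c, K (t - c *: 1).
  rewrite r0 in Ft; elim: Ft => [a Ka|s _ |a b _ [c Kc] _ [d Kd]|d a _ [c Kc]].
  - by exists 0; rewrite scale0r subr0.
  - by case: s => // _; exists 1; rewrite scale1r subrr.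
  - by exists (c + d); rewrite scalerDl opprD addrACA; apply: KD.
  - by exists (d * c); rewrite -scalerA -scalerBr; apply: KZ.
have c_neq0 : c != 0.
  by apply/eqP=> c0; apply: nKt; rewrite c0 scale0r subr0 in Kc.
have : S (c *: 1).
  by rewrite -[c *: 1](subKr t); apply/SD/SN/SK.
by move/(SZ c^-1); rewrite scalerA mulVf // scale1r.
Qed.

End Filtration.

(** * The tensor algebra and the ideal of the induced module *)

Lemma malg_scalerAr (I : monomType) (R : comNzRingType) (c : R) (a b : {malg R[I]}) :
  c *: (a * b) = a * (c *: b).
Proof.
have sub (g : {malg R[I]}) : fsubset (msupp g) (msupp g) := fsubset_refl _.
apply/malgP => m; rewrite mcoeffZ (mcoeffMlw _ (sub a) (sub b)).
rewrite (mcoeffMlw _ (sub a) (msuppZ_le c b)).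
rewrite mulr_sumr; apply: eq_bigr => i _.
rewrite mulr_sumr; apply: eq_bigr => j _.
by rewrite mcoeffZ mulrCA mulrnAr.
Qed.

Lemma malg_scaleU (I : choiceType) (R : nzRingType) (c : R) (k : I) :
  c *: << k >> = << c *g k >>.
Proof. by apply/malgP => k'; rewrite mcoeffZ !mcoeffU mulr_natr. Qed.

HB.instance Definition _ (C : fieldType) := GRing.Lalgebra.on (TL C).
HB.instance Definition _ (C : fieldType) :=
  GRing.Lalgebra_isAlgebra.Build C (TL C) (@malg_scalerAr _ _).

Lemma gen_fmonom (C : fieldType) x (s : seq HVbasis) :
  gen C x * << FMonom s >> = << FMonom (x :: s) >>.
Proof.
rewrite [LHS]fgmulUU mulr1 fmuE; congr mkmalgU.
by rewrite /mul /= fmmulE.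
Qed.

Lemma TL_monom_ind (C : fieldType) (Q : TL C -> Prop) :
  (forall a b, Q a -> Q b -> Q (a + b)) -> (forall c a, Q a -> Q (c *: a)) ->
  (forall s : seq HVbasis, Q << FMonom s >>) -> forall t, Q t.
Proof.
move=> QD QZ QU t.
have Q0 : Q 0 by rewrite -(scale0r << FMonom [::] >>); apply: QZ.
rewrite (monalgE t); elim/big_ind: _ => // k _.
by rewrite -malg_scaleU -[k in << k >>]fmK; apply: QZ.
Qed.

Lemma TL_ind (C : fieldType) (Q : TL C -> Prop) :
  (forall a b, Q a -> Q b -> Q (a + b)) -> (forall c a, Q a -> Q (c *: a)) ->
  Q 1 -> (forall x a, Q a -> Q (gen C x * a)) -> forall t, Q t.
Proof.
move=> QD QZ Q1 QM; apply: TL_monom_ind => //; elim=> [|x s IH].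
  by rewrite -fmoneE.
by rewrite -gen_fmonom; apply: QM.
Qed.

Lemma commutator_lmul (T : nzRingType) (x y b v : T) :
  x * (y * v) - (y * (x * v) + b * v) = 1 * (x * y - y * x - b) * v.
Proof. by rewrite mul1r 2!mulrBl opprD addrA -!mulrA. Qed.

Section Ideal.
Variables (C : fieldType) (phi : pbasis -> C).
Implicit Types (t u v : TL C).

Lemma inK_lmul u t : inK phi t -> inK phi (u * t).
Proof.
elim=> [v w x y|v g||a b _ Ka _ Kb|c a _ Ka].
- by rewrite !mulrA; apply: K_rel.
- by rewrite mulrA; apply: K_ind.
- by rewrite mulr0; apply: K_zero.
- by rewrite mulrDr; apply: K_add.
- by rewrite -scalerAr; apply: K_scale.
Qed.

Lemma inK_swap x y v :
  inK phi (gen C x * (gen C y * v) - (gen C y * (gen C x * v) + HVbracket C x y * v)).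
Proof.
by rewrite commutator_lmul; apply: K_rel.
Qed.

End Ideal.

(** * Polynomials in infinitely many variables *)

Section FreeCommutativeAlgebra.
Variables (V : choiceType) (C : comNzRingType).
Local Notation P := {malg C[{cmonom V}]}.

(** A monomial other than 1 is a variable times a monomial of smaller degree. *)
Lemma cmonom_algebra_ind (Q : P -> Prop) :
  (forall a b, Q a -> Q b -> Q (a + b)) -> (forall c a, Q a -> Q (c *: a)) ->
  (forall a b, Q a -> Q b -> Q (a * b)) ->
  Q 1 -> (forall i, Q << ucm i >>) -> forall t, Q t.
Proof.
move=> QD QZ QM Q1 QX t.
have Q0 : Q 0 by rewrite -(scale0r 1); apply: QZ.
have QU n : forall m : {cmonom V}, (mdeg m <= n)%N -> Q << m >>.
  elim: n => [|n IH] m le_mn.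
    by move: le_mn; rewrite leqn0 mdeg_eq0 => /eqP->; exact: Q1.
  have [/eqP|] := boolP (m == mone); first by move->; exact: Q1.
  rewrite -mdeg_eq0 -lt0n => m_gt0.
  have [i mi] : exists i, i \in finsupp m.
    apply/fset0Pn; apply: contraTneq m_gt0 => m0.
    by rewrite /mdeg m0 big_seq_fset0.
  pose m' := divcm m (ucm i).
  have def_m : m = mmul (ucm i) m'.
    apply/eqP/cmP => j; rewrite cmM ucmE divcmE ucmE subnKC //.
    by case: eqP => // <-; rewrite lt0n cmE_neq0.
  have -> : << m >> = << ucm i >> * << m' >> :> P.
    by rewrite [RHS]fgmulUU mulr1 -def_m.
  have deg_m : mdeg m = (mdeg (ucm i) + mdeg m')%N by rewrite {1}def_m; exact: mdegM.
  apply: QM; first exact: QX.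
  apply: IH.
  by rewrite deg_m mdegU in le_mn.
rewrite (monalgE t).
apply: (big_ind Q Q0 QD) => m _.
rewrite -malg_scaleU.
apply: QZ.
exact: (QU (mdeg m)).
Qed.

Section Extension.
Variables (S : comNzRingType) (f : {rmorphism C -> S}) (s : V -> S).

Definition cmonom_eval (m : {cmonom V}) : S := \prod_(i <- finsupp m) s i ^+ m i.

Lemma cmonom_evalEw (d : {fset V}) (m : {cmonom V}) : fsubset (finsupp m) d ->
  cmonom_eval m = \prod_(i <- d) s i ^+ m i.
Proof.
move=> sub; rewrite [LHS](big_fset_incl _ sub) // => i _.
by rewrite -cmE_eq0 => /eqP->; rewrite expr0.
Qed.

Lemma cmonom_eval_mmorphism : mmorphism cmonom_eval.
Proof.
split=> [m1 m2|]; last by rewrite /cmonom_eval mdom1 big_seq_fset0.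
rewrite {1}/cmonom_eval mdomD (cmonom_evalEw (fsubsetUl _ (finsupp m2))).
rewrite (cmonom_evalEw (fsubsetUr (finsupp m1) _)) -big_split /=.
by apply: eq_bigr => i _; rewrite cmM exprD.
Qed.

HB.instance Definition _ :=
  isMultiplicative.Build {cmonom V} S cmonom_eval cmonom_eval_mmorphism.

(** Universal property of the polynomial algebra. It provides the evaluations and, with target
    [{poly P}], the derivations. *)
Lemma cmonom_extension : exists g : {rmorphism P -> S},
  (forall c a, g (c *: a) = f c * g a) /\ (forall i, g << ucm i >> = s i).
Proof.
exists (mmap f cmonom_eval : {rmorphism P -> S}); split=> [c a|i] /=.
  exact: mmapZ.
have -> : mmap f cmonom_eval << ucm i >> = f 1 * cmonom_eval (ucm i).
  exact: mmapU.
by rewrite rmorph1 mul1r /cmonom_eval mdomU big_seq_fset1 cmUU expr1.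
Qed.

End Extension.
End FreeCommutativeAlgebra.

(** * Functionals vanishing on the ideal *)

Section RightAction.
Variables (C : fieldType) (T : algType C) (M : lmodType C).
Variables (gen : HVbasis -> T) (rho : HVbasis -> M -> M) (act : T -> M -> M).
Hypothesis T_ind : forall Q : T -> Prop,
  (forall a b, Q a -> Q b -> Q (a + b)) -> (forall c a, Q a -> Q (c *: a)) ->
  Q 1 -> (forall x a, Q a -> Q (gen x * a)) -> forall t, Q t.
Hypotheses (rhoD : forall x f g, rho x (f + g) = rho x f + rho x g)
  (rhoZ : forall x c f, rho x (c *: f) = c *: rho x f).
Hypotheses (actDl : forall t u f, act (t + u) f = act t f + act u f)
  (actZl : forall c t f, act (c *: t) f = c *: act t f)
  (act1 : forall f, act 1 f = f)
  (act_genM : forall x t f, act (gen x * t) f = act t (rho x f)).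

Lemma actBl t u f : act (t - u) f = act t f - act u f.
Proof. by rewrite actDl -(scaleN1r u) actZl scaleN1r. Qed.

Lemma act_gen x f : act (gen x) f = rho x f.
Proof. by rewrite -[gen x]mulr1 act_genM act1. Qed.

Lemma actM t u f : act (t * u) f = act u (act t f).
Proof.
have actD v : forall g h, act v (g + h) = act v g + act v h.
  elim/T_ind: v => [a b IHa IHb|c a IH||x a IH] g h.
  - by rewrite !actDl IHa IHb addrACA.
  - by rewrite !actZl IH scalerDr.
  - by rewrite !act1.
  - by rewrite !act_genM rhoD IH.
have actZ v c : forall g, act v (c *: g) = c *: act v g.
  elim/T_ind: v => [a b IHa IHb|d a IH||x a IH] g.
  - by rewrite !actDl IHa IHb scalerDr.
  - by rewrite !actZl IH !scalerA mulrC.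
  - by rewrite !act1.
  - by rewrite !act_genM rhoZ IH.
elim/T_ind: t f => [a b IHa IHb|c a IH||x a IH] f.
- by rewrite mulrDl !actDl IHa IHb actD.
- by rewrite -scalerAl !actZl IH actZ.
- by rewrite mul1r act1.
- by rewrite -mulrA !act_genM IH.
Qed.

Lemma act0 t : act t 0 = 0.
Proof.
elim/T_ind: t => [a b IHa IHb|d a IH||x a IH].
- by rewrite actDl IHa IHb addr0.
- by rewrite actZl IH scaler0.
- exact: act1.
- by rewrite act_genM -(scale0r 0) rhoZ !scale0r.
Qed.

Lemma act_commutator u x y b v f :
  (forall g, rho y (rho x g) - rho x (rho y g) = act b g) ->
  act (u * (gen x * gen y - gen y * gen x - b) * v) f = 0.
Proof.
by move=> rel; rewrite !actM !actBl !actM !act_gen rel subrr act0.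
Qed.

Lemma act_subscalar u x c f :
  act (u * (gen x - c%:A)) f = rho x (act u f) - c *: act u f.
Proof. by rewrite actM actBl act_gen actZl act1. Qed.

Lemma act_lin2 a x b y f :
  act (a *: gen x + b *: gen y) f = a *: rho x f + b *: rho y f.
Proof. by rewrite actDl !actZl !act_gen. Qed.

Lemma act_linN2 a x b y f :
  act (- (a *: gen x + b *: gen y)) f = - (a *: rho x f + b *: rho y f).
Proof. by rewrite -(scaleN1r (a *: gen x + b *: gen y)) actZl act_lin2 scaleN1r. Qed.

Lemma act_lin1 a x f : act (a *: gen x) f = a *: rho x f.
Proof. by rewrite actZl act_gen. Qed.

Lemma act_sub1 u x f : act (1 - u * gen x) f = f - rho x (act u f).
Proof. by rewrite actBl act1 actM act_gen. Qed.

End RightAction.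

Lemma mull_intertwineD (C : fieldType) (T : algType C) (M : lmodType C)
    (act : T -> M -> M) (r : M -> M) (x a b : T) :
  (forall t u f, act (t + u) f = act t f + act u f) ->
  (forall f, act (x * a) f = act a (r f)) ->
  (forall f, act (x * b) f = act b (r f)) ->
  forall f, act (x * (a + b)) f = act (a + b) (r f).
Proof. by move=> actDl Ha Hb f; rewrite mulrDr !actDl Ha Hb. Qed.

Lemma mull_intertwineZ (C : fieldType) (T : algType C) (M : lmodType C)
    (act : T -> M -> M) (r : M -> M) (x a : T) (c : C) :
  (forall c t f, act (c *: t) f = c *: act t f) ->
  (forall f, act (x * a) f = act a (r f)) ->
  forall f, act (x * (c *: a)) f = act (c *: a) (r f).
Proof. by move=> actZl Ha f; rewrite -scalerAr !actZl Ha. Qed.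

Section Action.
Variables (C : fieldType) (M : lmodType C) (rho : HVbasis -> M -> M).
Hypotheses (rhoD : forall x f g, rho x (f + g) = rho x f + rho x g)
  (rhoZ : forall x c f, rho x (c *: f) = c *: rho x f).

Definition act_fmonom (k : {fmonom HVbasis}) (f : M) : M :=
  foldl (fun f x => rho x f) f k.

(* [rho] is applied in reading order: [act] is a right action, and [t] acts on
   a functional by precomposition with [act t]. *)
Definition act (t : TL C) (f : M) : M :=
  \sum_(k <- msupp t) t@_k *: act_fmonom k f.

Lemma actEw (d : {fset {fmonom HVbasis}}) t f : fsubset (msupp t) d ->
  act t f = \sum_(k <- d) t@_k *: act_fmonom k f.
Proof.
move=> sub; rewrite /act (big_fset_incl _ sub) // => k _ /mcoeff_outdom->.
by rewrite scale0r.
Qed.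

Lemma actDl t u f : act (t + u) f = act t f + act u f.
Proof.
rewrite (actEw f (msuppD_le t u)) (actEw f (fsubsetUl (msupp t) (msupp u))).
rewrite (actEw f (fsubsetUr (msupp t) (msupp u))) -big_split.
by apply: eq_bigr => k _; rewrite mcoeffD scalerDl.
Qed.

Lemma actZl c t f : act (c *: t) f = c *: act t f.
Proof.
rewrite (actEw f (msuppZ_le c t)) /act scaler_sumr.
by apply: eq_bigr => k _; rewrite mcoeffZ scalerA.
Qed.

Lemma act0l f : act 0 f = 0.
Proof. by rewrite /act msupp0 big_seq_fset0. Qed.

Lemma act_fmonomE s f : act << FMonom s >> f = foldl (fun f x => rho x f) f s.
Proof. by rewrite /act msuppU1 big_seq_fset1 mcoeffUU scale1r. Qed.

Lemma act1 f : act 1 f = f.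
Proof. by have := act_fmonomE [::] f; rewrite -fmoneE. Qed.

Lemma act_genM x t f : act (gen C x * t) f = act t (rho x f).
Proof.
elim/TL_monom_ind: t f => [a b IHa IHb|c a IH|s].
- exact: (mull_intertwineD actDl IHa IHb).
- exact: (@mull_intertwineZ C (TL C) M act (rho x) (gen C x) a c actZl IH).
- by move=> f; rewrite gen_fmonom !act_fmonomE.
Qed.

(* The induced module is tested against functionals on [M] killed by
   [rho g - phi g] for [g] in the subalgebra p. *)
Lemma inK_functional (phi : pbasis -> C) (lam : M -> C) :
  (forall a b, lam (a + b) = lam a + lam b) ->
  (forall c a, lam (c *: a) = c * lam a) ->
  (forall x y f, rho y (rho x f) - rho x (rho y f) = act (HVbracket C x y) f) ->
  (forall g f, lam (rho (p_to_HV g) f) = phi g * lam f) ->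
  forall t, inK phi t -> forall f, lam (act t f) = 0.
Proof.
move=> lamD lamZ rho_rel lam_p t.
have lam0 : lam 0 = 0 by rewrite -(scale0r 0) lamZ mul0r.
elim=> [u v x y|u g||a b _ IHa _ IHb|c a _ IH] f.
- by rewrite (act_commutator (@TL_ind C) rhoD rhoZ actDl actZl act1 act_genM).
- rewrite (act_subscalar (@TL_ind C) rhoD rhoZ actDl actZl act1 act_genM).
  by rewrite -scaleN1r lamD !lamZ lam_p mulN1r subrr.
- by rewrite act0l.
- by rewrite actDl lamD IHa IHb addr0.
- by rewrite actZl lamZ IH mulr0.
Qed.

End Action.

(** * Derivations with prescribed values on the variables *)

Section Derivation.
Variables (V : Type) (C : comNzRingType) (P : comAlgType C) (X : V -> P).
Hypothesis P_ind : forall Q : P -> Prop,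
  (forall a b, Q a -> Q b -> Q (a + b)) -> (forall c a, Q a -> Q (c *: a)) ->
  (forall a b, Q a -> Q b -> Q (a * b)) -> Q 1 -> (forall i, Q (X i)) ->
  forall t, Q t.
Hypothesis P_ext : forall (S : comNzRingType) (f : {rmorphism C -> S}) (s : V -> S),
  exists g : {rmorphism P -> S},
    (forall c a, g (c *: a) = f c * g a) /\ (forall i, g (X i) = s i).

(* The linear coefficient of the morphism [X i |-> X i + d i * epsilon]. *)
Lemma derivation_exists (d : V -> P) : exists D : P -> P,
  [/\ forall a b, D (a + b) = D a + D b, forall c a, D (c *: a) = c *: D a,
      forall a b, D (a * b) = D a * b + a * D b & forall i, D (X i) = d i].
Proof.
pose f := polyC \o in_alg P : {rmorphism C -> {poly P}}.
have [g [gZ gX]] := P_ext f (fun i => (X i)%:P + d i *: 'X).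
(* The constant coefficient of [g] is the identity, which turns multiplicativity into the Leibniz
   rule at coefficient 1. *)
have g0 a : (g a)`_0 = a.
  elim/P_ind: a => [a b IHa IHb|c a IH|a b IHa IHb||i].
  - by rewrite rmorphD coefD IHa IHb.
  - by rewrite gZ coefCM IH mulr_algl.
  - by rewrite rmorphM coefM big_ord_recl big_ord0 addr0 /= subn0 IHa IHb.
  - by rewrite rmorph1 coefC.
  - by rewrite gX coefD coefC coefZ coefX mulr0 addr0.
exists (fun a => (g a)`_1); split=> [a b|c a|a b|i].
- by rewrite rmorphD coefD.
- by rewrite gZ coefCM mulr_algl.
- rewrite rmorphM coefM !big_ord_recl big_ord0 addr0 /= /bump /= !subn0 subnn !g0.
  by rewrite addrC.
- by rewrite gX coefD coefC coefZ coefX mulr1 add0r.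
Qed.

End Derivation.

(** * A representation by differential operators, and evaluations on it *)

Section Model.
Variables (C : numFieldType) (phi : pbasis -> C).
Hypotheses (phi_z2 : phi pz2 = 0) (phi_z3 : phi pz3 = 0).
Variables (P : comAlgType C) (X : bool * int -> P).
Hypothesis P_ind : forall Q : P -> Prop,
  (forall a b, Q a -> Q b -> Q (a + b)) -> (forall c a, Q a -> Q (c *: a)) ->
  (forall a b, Q a -> Q b -> Q (a * b)) -> Q 1 -> (forall i, Q (X i)) ->
  forall t, Q t.

(* The scaling that makes [rho] below have central charge [phi pz1]. *)
Let kappa : C := - (phi pz1 / 24%:R).

(** The central term of [L_m, I_j] with the scalar [kappa] in place of [z2], attached to the second
    family only. *)
Definition anomaly (b : bool) (m j : int) : C :=
  if b && (m + j == 0) then kappa * (m ^+ 2 + m)%:~R else 0.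

Variable D : int -> P -> P.
Hypotheses (DD : forall m a b, D m (a + b) = D m a + D m b)
  (DZ : forall m c a, D m (c *: a) = c *: D m a)
  (DM : forall m a b, D m (a * b) = D m a * b + a * D m b)
  (DX : forall m b j,
    D m (X (b, j)) = j%:~R * X (b, m + j) + (anomaly b m j)%:A).

Lemma D1 m : D m 1 = 0.
Proof.
have := DM m 1 1; rewrite !mulr1 mul1r => /(congr1 (+%R^~ (- D m 1))).
by rewrite addrK subrr.
Qed.

Lemma D0 m : D m 0 = 0.
Proof. by rewrite -(scale0r 0) DZ !scale0r. Qed.

Lemma D_alg m c : D m c%:A = 0.
Proof. by rewrite DZ D1 scaler0. Qed.

Lemma intr_scale (z : int) (a : P) : z%:~R * a = z%:~R *: a.
Proof. by rewrite -(rmorph_int (in_alg P)) mulr_algl. Qed.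

Lemma D_int m (z : int) a : D m (z%:~R * a) = z%:~R * D m a.
Proof. by rewrite !intr_scale DZ. Qed.

(** Cocycle identity: it matches the constant terms of the two sides of [D_comm] on a variable. *)
Lemma anomaly_jacobi b m n j :
  j%:~R * (anomaly b m (n + j) - anomaly b n (m + j))
  = (n - m)%:~R * anomaly b (m + n) j.
Proof.
rewrite /anomaly !addrA (addrC n m); case: b => /=; last by rewrite subrr !mulr0.
case: eqP => [z|_]; last by rewrite subrr !mulr0.
have -> : j = - (m + n) by lia.
by rewrite !(intrD, rmorphN, rmorphXn, rmorphB) /=; ring.
Qed.

(** Both sides are derivations in [a], so the variables decide. *)
Lemma D_comm m n a : D m (D n a) - D n (D m a) = (n - m)%:~R * D (m + n) a.
Proof.
elim/P_ind: a => [a b IHa IHb|c a IH|a b IHa IHb||[b j]].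
- by rewrite !DD mulrDr -IHa -IHb; ring.
- by rewrite !DZ -scalerBr IH scalerAr.
- rewrite !DM !DD !DM mulrDr mulrA (mulrCA _ a) -IHa -IHb; ring.
- by rewrite !D1 !D0 subrr mulr0.
- rewrite !DX !DD !D_int !D_alg !DX !addr0 mulrDr.
  rewrite [X (b, n + (m + j))](_ : _ = X (b, m + n + j)); last by congr (X (_, _)); lia.
  rewrite addrA; set x := X _.
  have := congr1 (in_alg P) (anomaly_jacobi b m n j).
  rewrite !rmorphM !rmorphB !rmorph_int /= => jac.
  rewrite [in RHS]mulrDr -jac !intrD; ring.
Qed.

(* Polynomial functions on the dual of p enlarged by a second family of I's:
   [X (false, n)] is the coordinate I_n, [X (true, n)] the coordinate J_n, where
   [L_m, J_n] = n J_(m+n) + delta kappa (m^2 + m), and L_m acts by minus the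
   vector field [D m]. With commuting J's, shifting L_m by (m + 1) J_m keeps the
   Witt relations and creates a central charge. *)
Definition rho (x : HVbasis) (f : P) : P :=
  match x with
  | Lb m => - D m f + (m + 1)%:~R * (X (true, m) * f)
  | Ib n => X (false, n) * f
  | z1b => phi pz1 *: f
  | _ => 0
  end.

Lemma rhoD x f g : rho x (f + g) = rho x f + rho x g.
Proof.
case: x => [m|n|||] /=; rewrite ?addr0 ?scalerDr ?mulrDr //.
rewrite DD opprD; ring.
Qed.

Lemma rhoZ x c f : rho x (c *: f) = c *: rho x f.
Proof.
case: x => [m|n|||] /=; rewrite ?scaler0 -?scalerAr //.
  by rewrite DZ scalerDr scalerN.
by rewrite !scalerA mulrC.
Qed.

Lemma rho_LL m n f :
  rho (Lb n) (rho (Lb m) f) - rho (Lb m) (rho (Lb n) f) =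
  (n - m)%:~R *: rho (Lb (m + n)) f +
  (delta0 C (m + n) * ((m ^+ 3 - m)%:~R / 12%:R)) *: (phi pz1 *: f).
Proof.
rewrite /= -!intr_scale.
have DDN a b k : D k (- a + b) = - D k a + D k b.
  by rewrite DD -scaleN1r DZ scaleN1r.
rewrite !DDN !D_int !DM !DX (addrC n m).
have /eqP := D_comm m n f; rewrite subr_eq => /eqP->.
set u := X (true, m + n).
(* At [n = - m] the left side is [-2 * kappa * (m^3 - m)], which explains the 24 in [kappa]. *)
have anom : (n + 1)%:~R * anomaly true m n - (m + 1)%:~R * anomaly true n m
    = delta0 C (m + n) * ((m ^+ 3 - m)%:~R / 12%:R) * phi pz1.
  rewrite /anomaly /delta0 /= (addrC n m); case: eqP => [z|_]; last by ring.
  have -> : n = - m by lia.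
  by rewrite /kappa !(intrD, rmorphN, rmorphXn, rmorphB, rmorphD) /=; field.
rewrite scalerA -anom -[_ *: f]mulr_algl scalerBl -!scalerA -!intr_scale.
rewrite !intrD !rmorphN /=; ring.
Qed.

Lemma rho_LI m n f :
  rho (Ib n) (rho (Lb m) f) - rho (Lb m) (rho (Ib n) f) = n%:~R *: rho (Ib (m + n)) f.
Proof.
rewrite /= -!intr_scale DM DX /anomaly /= scale0r addr0; ring.
Qed.

Lemma rho_bracket x y f :
  rho y (rho x f) - rho x (rho y f) = act rho (HVbracket C x y) f.
Proof.
have scale w (a : C) g : rho w (a *: g) - a *: rho w g = 0.
  by rewrite rhoZ subrr.
have rho0 w : rho w 0 = 0 by rewrite -(scale0r 0) rhoZ !scale0r.
have lin1 := act_lin1 (actZl rho) (act1 rho) (act_genM rho).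
have lin2 := act_lin2 (actDl rho) (actZl rho) (act1 rho) (act_genM rho).
have linN2 := act_linN2 (actDl rho) (actZl rho) (act1 rho) (act_genM rho).
case: x => [m|m|||].
- case: y => [n|n|||]; rewrite /HVbracket.
  + by rewrite lin2; exact: rho_LL.
  + by rewrite lin2 scaler0 addr0; exact: rho_LI.
  + by rewrite act0l -opprB (scale (Lb m)) oppr0.
  + by rewrite act0l rho0 subrr.
  + by rewrite act0l rho0 subrr.
- case: y => [n|n|||]; rewrite /HVbracket.
  + by rewrite linN2 scaler0 addr0 -rho_LI opprB.
  + by rewrite lin1 scaler0 /= mulrCA subrr.
  + by rewrite act0l -opprB (scale (Ib m)) oppr0.
  + by rewrite act0l rho0 subrr.
  + by rewrite act0l rho0 subrr.
- by rewrite act0l; apply: scale.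
- by rewrite act0l rho0 subrr.
- by rewrite act0l rho0 subrr.
Qed.

Variable psi : int -> C.
Variable lam : {rmorphism P -> C}.
Hypotheses (lamZ : forall c a, lam (c *: a) = c * lam a)
  (lam_I : forall j, lam (X (false, j)) = phi (pI j))
  (lam_J : forall j, lam (X (true, j)) = psi j).

Lemma lam_act_K t : inK phi t -> forall f, lam (act rho t f) = 0.
Proof.
apply: inK_functional => //; [exact: rhoD|exact: rhoZ|exact: rmorphD|
  exact: rho_bracket|].
move=> [n|||] f /=.
- by rewrite rmorphM lam_I.
- exact: lamZ.
- by rewrite phi_z2 mul0r rmorph0.
- by rewrite phi_z3 mul0r rmorph0.
Qed.

Lemma one_notin_K : ~ inK phi 1.
Proof.
by move=> /lam_act_K/(_ 1)/eqP; rewrite act1 rmorph1 oner_eq0.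
Qed.

(** The test polynomial is [X (true, j)] with [j = |r| + 1], so that [j] and [r + j] are nonzero. As
    [psi] is 1 at [r + j] and 0 elsewhere, only the term [- j] survives. *)
Lemma L_notin_K r : (forall j, psi j = (j == r + (absz r).+1%:Z)%:R) ->
  ~ inK phi (gen C (Lb r)).
Proof.
move=> psiE /lam_act_K; set j := (absz r).+1%:Z.
move=> /(_ (X (true, j)))/eqP; rewrite (act_gen (act1 rho) (act_genM rho)).
rewrite /= rmorphD rmorphN DX rmorphD.
rewrite lamZ !rmorphM !rmorph_int !lam_J !psiE /anomaly /=.
have /negPf-> : r + j != 0 by lia.
have /negPf-> : r != r + (absz r).+1%:Z by lia.
rewrite eqxx mul0r !addr0 mulr1 mul0r mulr0 addr0 oppr_eq0 intr_eq0; lia.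
Qed.

(** The evaluation point is a zero of the vector field [D r] and [psi r = 0], so [lam] kills the
    image of [rho (Lb r)], while its value at 1 is 1. On [X (true, - r)] the choice of [psi 0]
    cancels the anomaly. *)
Lemma one_notin_KL r u : (forall n, n != r -> phi (pI n) = 0) ->
  (forall j, psi j = if (j == 0) && (r != 0) then kappa * (r + 1)%:~R else 0) ->
  ~ inK phi (1 - u * gen C (Lb r)).
Proof.
move=> phi_r psiE /lam_act_K/(_ 1)/eqP.
have lamD f : lam (D r f) = 0.
  elim/P_ind: f => [a b IHa IHb|c a IH|a b IHa IHb||[b j]].
  - by rewrite DD rmorphD IHa IHb addr0.
  - by rewrite DZ lamZ IH mulr0.
  - by rewrite DM rmorphD !rmorphM IHa IHb mul0r mulr0 addr0.
  - by rewrite D1 rmorph0.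
  rewrite DX rmorphD rmorphM rmorph_int lamZ rmorph1 mulr1 /anomaly.
  case: b => /=; last first.
    rewrite lam_I addr0; have [->|nz_j] := eqVneq j 0; first by rewrite mul0r.
    by rewrite phi_r ?mulr0 //; lia.
  rewrite lam_J psiE; case: eqP => [rj|_] /=; last by rewrite mulr0 addr0.
  have -> : j = - r by lia.
  have [->|_] /= := eqVneq r 0; last first.
    by rewrite !(intrD, rmorphN, rmorphXn) /=; ring.
  by rewrite mulr0 addr0 expr0n mulr0 addr0.
rewrite (act_sub1 (@TL_ind C) rhoD rhoZ (actDl rho) (actZl rho) (act1 rho)
  (act_genM rho)).
rewrite rmorphB rmorph1 /= rmorphD rmorphN lamD !rmorphM lam_J psiE.
have -> : (r == 0) && (r != 0) = false by case: eqP.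
by rewrite mul0r mulr0 oppr0 addr0 subr0 oner_eq0.
Qed.

End Model.

(** * The irreducibility criterion *)

Lemma induced_module_facts (C : numFieldType) (phi : pbasis -> C) :
  phi pz2 = 0 -> phi pz3 = 0 ->
  [/\ ~ inK phi 1, forall r, ~ inK phi (gen C (Lb r))
    & forall r u, (forall n, n != r -> phi (pI n) = 0) ->
        ~ inK phi (1 - u * gen C (Lb r))].
Proof.
move=> z2 z3.
pose P : comAlgType C := {malg C[{cmonom (bool * int)%type}]}.
pose X i : P := << ucm i >>.
have P_ind := @cmonom_algebra_ind (bool * int)%type C : forall Q : P -> Prop, _.
have P_ext (S : comNzRingType) (f : {rmorphism C -> S}) (s : bool * int -> S) :
  exists g : {rmorphism P -> S},
    (forall c a, g (c *: a) = f c * g a) /\ (forall i, g (X i) = s i).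
  exact: cmonom_extension.
pose dX m (i : bool * int) : P :=
  i.2%:~R * X (i.1, m + i.2) + (anomaly phi i.1 m i.2)%:A.
have [D DP] := choice (fun m => derivation_exists P_ind P_ext (dX m)).
have DD m := let: And4 H _ _ _ := DP m in H.
have DZ m := let: And4 _ H _ _ := DP m in H.
have DM m := let: And4 _ _ H _ := DP m in H.
have DX m b j : D m (X (b, j)) = dX m (b, j).
  by case: (DP m) => _ _ _; apply.
have eval psi : exists lam : {rmorphism P -> C},
    [/\ forall c a, lam (c *: a) = c * lam a,
        forall j, lam (X (false, j)) = phi (pI j)
      & forall j, lam (X (true, j)) = psi j].
  have [lam [lamZ lamX]] := P_ext C (GRing.RMorphism.clone _ _ idfun _)
    (fun i => if i.1 then psi i.2 else phi (pI i.2)).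
  by exists lam; split=> // j; rewrite lamX.
split=> [|r|r u phi_r].
- have [lam [lamZ lamI lamJ]] := eval (fun=> 0).
  exact: (one_notin_K z2 z3 P_ind DD DZ DM DX lamZ lamI).
- have [lam [lamZ lamI lamJ]] := eval (fun j => (j == r + (absz r).+1%:Z)%:R).
  exact: (L_notin_K z2 z3 P_ind DD DZ DM DX lamZ lamI lamJ (fun=> erefl)).
- have [lam [lamZ lamI lamJ]] := eval (fun j =>
    if (j == 0) && (r != 0) then - (phi pz1 / 24%:R) * (r + 1)%:~R else 0).
  exact: (one_notin_KL z2 z3 P_ind DD DZ DM DX lamZ lamI lamJ phi_r (fun=> erefl)).
Qed.

Lemma subr_add_mul0 (T : nzRingType) (a b v : T) : a - (b + 0 * v) = a - b.
Proof. by rewrite mul0r addr0. Qed.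

Lemma mulr_lin2l (C : nzRingType) (T : lalgType C) (a b : C) (x y v : T) :
  (a *: x + b *: y) * v = a *: (x * v) + b *: (y * v).
Proof. by rewrite mulrDl !scalerAl. Qed.

(** For [K] the ideal of the induced module, [S] is the preimage of the submodule generated by the
    class of [y]. *)
Lemma add_principal_closed (C : nzRingType) (T : lalgType C) (K : T -> Prop) (y : T) :
  (forall a b, K a -> K b -> K (a + b)) -> (forall c a, K a -> K (c *: a)) ->
  (forall u a, K a -> K (u * a)) -> let S t := exists u, K (t - u * y) in
  [/\ forall a b, S a -> S b -> S (a + b), forall c a, S a -> S (c *: a)
    & forall x a, S a -> S (x * a)].
Proof.
move=> KD KZ KM; split=> [a b [u Ku] [v Kv]|c a [u Ku]|x a [u Ku]].
- by exists (u + v); rewrite mulrDl opprD addrACA; apply: KD.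
- by exists (c *: u); rewrite -scalerAl -scalerBr; apply: KZ.
- by exists (x * u); rewrite -mulrA -mulrBr; apply: KM.
Qed.

Lemma seq_max (s : seq int) x : x \in s ->
  exists2 M, M \in s & forall y, y \in s -> y <= M.
Proof.
elim: s x => // a s IH x _; case: s IH => [_|b s IH].
  by exists a; rewrite ?mem_head // => y; rewrite inE => /eqP->.
have [M Ms leM] := IH b (mem_head _ _).
have [leaM|ltMa] := leP a M.
  exists M; first by rewrite inE Ms orbT.
  by move=> y; rewrite inE => /predU1P[->|/leM].
exists a; first exact: mem_head.
by move=> y; rewrite inE => /predU1P[->|/leM/le_trans->] //; apply: ltW.
Qed.

Lemma supp_bounds (C : fieldType) (phi : int -> C) (s : seq int) (k l : int) :
  (forall n, phi n != 0 -> n \in s) -> k != l -> phi k != 0 -> phi l != 0 ->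
  exists N M, [/\ N < M, phi N != 0, phi M != 0
    & forall n, phi n != 0 -> N <= n <= M].
Proof.
move=> sP neq_kl nzk nzl; pose s' := [seq n <- s | phi n != 0].
have s'P n : (n \in s') = (phi n != 0).
  by rewrite mem_filter andb_idr // => /sP.
have ks' : k \in s' by rewrite s'P.
have [M Ms leM] := seq_max ks'.
have [N' /mapP[N Ns ->] leN] := seq_max (map_f (@GRing.opp int) ks').
have bnd n : phi n != 0 -> N <= n <= M.
  rewrite -s'P => ns; rewrite leM // andbT -lerN2.
  by apply: leN; apply: map_f.
exists N, M; split; rewrite -?s'P //.
have /andP[? ?] := bnd k nzk; have /andP[? ?] := bnd l nzl; lia.
Qed.

Lemma W_irreducibleP (C : numFieldType) (phi : pbasis -> C) :
  phi pz3 = 0 -> (exists s : seq int, forall n, phi (pI n) != 0 -> n \in s) ->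
  phi pz2 = 0 -> (exists r, phi (pI r) != 0) ->
  W_irreducible phi <->
  (exists m n : int, m <> n /\ phi (pI m) != 0 /\ phi (pI n) != 0).
Proof.
move=> z3 [s sP] z2 [r nzr].
have [K1 KL K1L] := induced_module_facts z2 z3.
split=> [[_ irr]|[k [l [/eqP neq_kl [nzk nzl]]]]].
  have [/hasP[n _ /andP[neq_nr nzn]]|/hasPn phi_r] :=
      boolP (has (fun n => (n != r) && (phi (pI n) != 0)) s).
    by exists n, r; split; [apply/eqP|].
  have {}phi_r n : n != r -> phi (pI n) = 0.
    move=> neq_nr; apply/eqP; apply/negPn/negP => nzn.
    by have := phi_r n (sP n nzn); rewrite neq_nr nzn.
  (* The preimage of the submodule generated by [L_r w_phi], which is nonzero by [KL] and proper by
     [K1L]. *)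
  pose S t := exists u, inK phi (t - u * gen C (Lb r)).
  have S_sub : W_submodule phi S.
    have [SD SZ SM] := add_principal_closed (gen C (Lb r)) (@K_add _ phi)
      (@K_scale _ phi) (@inK_lmul _ phi).
    split=> [t Kt||||x a]; [| |exact: SD|exact: SZ|exact: SM].
      by exists 0; rewrite mul0r subr0.
    by exists 0; rewrite mul0r subr0; apply: K_zero.
  have [S1|S1] := irr S S_sub.
  - case: (KL r); apply: S1; exists 1; rewrite mul1r subrr; exact: K_zero.
  - by have [u /(K1L r u phi_r)] := S1 1.
have [N [M [ltNM nzN nzM bnd]]] := supp_bounds sP neq_kl nzk nzl.
split=> // S [SK S0 SD SZ SM].
have [[t [St nKt]]|noS] := pselect (exists t, S t /\ ~ inK phi t); last first.
  by left=> t St; apply: contrapT => nKt; apply: noS; exists t.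
right; have S1 : S 1; last first.
  elim/TL_ind => [a b Sa Sb|c a Sa||x a Sa] //; first exact: SD.
    exact: SZ.
  exact: SM.
apply: (@submodule_contains1 C (TL C) (gen C) phi (inK phi)
  (@TL_ind C) (K_zero phi) (@K_add _ phi) (@K_scale _ phi) (@inK_lmul _ phi)
  _ _ _ _ z2 N M S t ltNM nzN nzM bnd SK SD SZ SM St nKt).
- by move=> g; have := K_ind phi 1 g; rewrite mul1r.
- move=> m n v; eexists; have := inK_swap phi (Lb m) (Lb n) v.
  rewrite mulr_lin2l; apply.
- move=> n m v; eexists; have := inK_swap phi (Ib n) (Lb m) v.
  rewrite mulNr mulr_lin2l; apply.
- move=> z m v zc; have Kz := inK_swap phi z (Lb m) v.
  have z0 : HVbracket C z (Lb m) = 0.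
    by move: zc; rewrite !inE => /or3P[] /eqP->.
  by rewrite z0 subr_add_mul0 in Kz.
Qed.

Theorem theorem4p4 (R : realType) (phi : pbasis -> R[i])
  (* phi is a Lie algebra homomorphism p -> C: it vanishes on [p,p] = C z3 *)
  (Hhom : phi pz3 = 0)
  (* phi is finite: S^phi = {n | phi(I_n) <> 0} is finite and phi(z2) = 0 *)
  (Hfin : exists s : seq int, forall n : int, phi (pI n) != 0 -> n \in s)
  (Hz2 : phi pz2 = 0)
  (* phi(H) <> 0, H = Span{I_r, z3} *)
  (HH : (exists r : int, phi (pI r) != 0) \/ phi pz3 != 0) :
  W_irreducible phi <->
  (exists m n : int, m <> n /\ phi (pI m) != 0 /\ phi (pI n) != 0).
Proof.
apply: (@W_irreducibleP R[i] phi Hhom Hfin Hz2).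
(* Since [phi] kills [z3], being nonzero on H means being nonzero at some [I_r]. *)
by case: HH => //; rewrite Hhom eqxx.
Qed.
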